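(* Let $d,n\in\mathbb{N}$, $\alpha>1/2$, let $\boldsymbol{\gamma}=(\gamma_1,\gamma_2,\ldots)$ satisfy $1\ge\gamma_1\ge\gamma_2\ge\cdots>0$, let $M\ge1$ be real, and let $\boldsymbol{z}\in\{0,1,\ldots,n-1\}^d$. Then $$\sum_{\boldsymbol{k}\in H_M}\ \sum_{\boldsymbol{0}\ne\boldsymbol{h}\in\Lambda(\boldsymbol{z},n)^\perp}\ \sum_{\boldsymbol{\sigma}\in\{\pm1\}^d}\frac{2^{|\boldsymbol{k}|_0}}{2^d\,r_{\alpha,\boldsymbol{\gamma}}(\boldsymbol{\sigma}(\boldsymbol{h})+\boldsymbol{k})}=\sum_{\boldsymbol{k}\in\widetilde H_M}\ \sum_{\boldsymbol{0}\ne\boldsymbol{h}\in\Lambda(\boldsymbol{z},n)^\perp}\frac{1}{r_{\alpha,\boldsymbol{\gamma}}(\boldsymbol{h}+\boldsymbol{k})}.$$ Consequently the upper bound $\frac1M+(\text{left-hand side})$ for the squared worst-case $L_2$ approximation error of the tent-transformed lattice algorithm in the cosine space equals the upper bound $\frac1M+(\text{right-hand side})$ for the squared worst-case $L_2$ approximation error of the corresponding lattice algorithm in the Korobov space with the same $\alpha$ and $\boldsymbol{\gamma}$.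
   Context: Notation. $\mathbb{Z}_+=\{0,1,2,\ldots\}$. For $\boldsymbol{k}\in\mathbb{Z}^d$, $|\boldsymbol{k}|_0$ is the number of non-zero components. For $\boldsymbol{\sigma}\in\{\pm1\}^d$, $\boldsymbol{\sigma}(\boldsymbol{k})=(\sigma_1k_1,\ldots,\sigma_dk_d)$. For $\boldsymbol{k}\in\mathbb{Z}^d$, $r_{\alpha,\boldsymbol{\gamma}}(\boldsymbol{k})=\prod_{j=1}^d r_{\alpha,\gamma_j}(k_j)$, where $r_{\alpha,\gamma_j}(0)=1$ and $r_{\alpha,\gamma_j}(k)=|k|^{2\alpha}/\gamma_j$ for $k\ne0$. Hyperbolic crosses: $H_M=\{\boldsymbol{k}\in\mathbb{Z}_+^d:r_{\alpha,\boldsymbol{\gamma}}(\boldsymbol{k})\le M\}$ and $\widetilde H_M=\{\boldsymbol{k}\in\mathbb{Z}^d:r_{\alpha,\boldsymbol{\gamma}}(\boldsymbol{k})\le M\}$. Dual lattice: $\Lambda(\boldsymbol{z},n)^\perp=\{\boldsymbol{h}\in\mathbb{Z}^d:\boldsymbol{h}\cdot\boldsymbol{z}\equiv0\pmod n\}$. Meaning of the two bounds (already established, used here only to name the two quantities). The cosine-space algorithm truncates the expansion of $f$ in the basis $\phi_{\boldsymbol{k}}(\boldsymbol{x})=(\sqrt2)^{|\boldsymbol{k}|_0}\prod_{j=1}^d\cos(\pi k_jx_j)$ to $\boldsymbol{k}\in H_M$ and approximates the coefficients by the equal-weight rule at the points $\psi(\tfrac{i\boldsymbol{z}}n\bmod1)$,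 $i=1,\ldots,n$, where $\psi(x)=1-|2x-1|$ componentwise; its squared worst-case $L_2$ error over the unit ball of the cosine space (norm $\|f\|^2=\sum_{\boldsymbol{k}\in\mathbb{Z}_+^d}|\hat f(\boldsymbol{k})|^2r_{\alpha,\boldsymbol{\gamma}}(\boldsymbol{k})$, with $\hat f(\boldsymbol{k})=\int_{[0,1]^d} f\phi_{\boldsymbol{k}}$) is bounded by $\frac1M$ plus the left-hand side. The Korobov-space algorithm truncates the Fourier series to $\widetilde H_M$ and approximates the Fourier coefficients by the equal-weight rule at the points $\tfrac{i\boldsymbol{z}}n\bmod1$; its squared worst-case $L_2$ error over the unit ball of the Korobov space (norm $\|f\|^2=\sum_{\boldsymbol{h}\in\mathbb{Z}^d}|\widetilde f(\boldsymbol{h})|^2r_{\alpha,\boldsymbol{\gamma}}(\boldsymbol{h})$, with $\widetilde f(\boldsymbol{h})$ the Fourier coefficients) is bounded by $\frac1M$ plus the right-hand side. *)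

(* Defs.v *)
(* MathComp-Analysis *)
From HB Require Import structures.
From mathcomp Require Export all_boot all_order all_algebra.
From mathcomp Require Export all_classical all_reals all_analysis.

Set Implicit Arguments.
Unset Strict Implicit.
Unset Printing Implicit Defensive.
Import Order.TTheory GRing.Theory Num.Theory.

Local Open Scope classical_set_scope.
Local Open Scope ring_scope.

Definition r_weight1 (R : realType) (alpha g : R) (k : int) : R :=
  if k == 0 then 1 else (`|k|%N%:R `^ (2 * alpha)) / g.

(* Coordinates are numbered from 0, and so are the weights: [gamma 0] is the
   first weight, usually written gamma_1. *)
Definition r_weight (R : realType) (alpha : R) (gamma : nat -> R) (d : nat)
    (k : 'rV[int]_d) : R :=
  \prod_(j < d) r_weight1 alpha (gamma j) (k 0 j).

Definition nnz (d : nat) (k : 'rV[int]_d) : nat := #|[pred j | k 0 j != 0]|.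

(* A sign vector in {+1,-1}^d is encoded by booleans: [true] stands for -1. *)
Definition sign_flip (d : nat) (s : {ffun 'I_d -> bool}) (k : 'rV[int]_d) :
    'rV[int]_d :=
  \row_j ((-1) ^+ s j * k 0 j).

Definition crossZ (R : realType) (alpha : R) (gamma : nat -> R) (d : nat)
    (M : R) : set 'rV[int]_d :=
  [set k : 'rV[int]_d | r_weight alpha gamma k <= M].

(* The hyperbolic cross over Z_+^d, seen as a subset of Z^d. *)
Definition crossN (R : realType) (alpha : R) (gamma : nat -> R) (d : nat)
    (M : R) : set 'rV[int]_d :=
  [set k : 'rV[int]_d | (forall j, 0 <= k 0 j) /\ r_weight alpha gamma k <= M].

Definition dual_lattice (d : nat) (z : 'rV[int]_d) (n : nat) :
    set 'rV[int]_d :=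
  [set h : 'rV[int]_d | (\sum_(j < d) h 0 j * z 0 j = 0 %[mod n])%Z].

(* All terms are nonnegative, so the sums are taken unconditionally, with
   values in [0, +oo]. *)
Definition cosine_sum (R : realType) (alpha : R) (gamma : nat -> R) (d n : nat)
    (M : R) (z : 'rV[int]_d) : \bar R :=
  (\esum_(k in crossN alpha gamma M)
     \esum_(h in dual_lattice z n `\ (0%R : 'rV[int]_d))
       \sum_(s : {ffun 'I_d -> bool})
         (2 ^+ nnz k /
            (2 ^+ d * r_weight alpha gamma (sign_flip s h + k)))%:E)%E.

Definition korobov_sum (R : realType) (alpha : R) (gamma : nat -> R)
    (d n : nat) (M : R) (z : 'rV[int]_d) : \bar R :=
  (\esum_(k in crossZ alpha gamma M)
     \esum_(h in dual_lattice z n `\ (0%R : 'rV[int]_d))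
       ((r_weight alpha gamma (h + k))^-1)%:E)%E.

(* The known upper bound for the squared worst-case L_2 error, over the unit
   ball of the cosine space, of the tent-transformed lattice algorithm that
   truncates the cosine expansion to [crossN]. *)
Definition cosine_bound (R : realType) (alpha : R) (gamma : nat -> R)
    (d n : nat) (M : R) (z : 'rV[int]_d) : \bar R :=
  ((M^-1)%:E + cosine_sum alpha gamma n M z)%E.

(* The known upper bound for the squared worst-case L_2 error, over the unit
   ball of the Korobov space, of the lattice algorithm that truncates the
   Fourier series to [crossZ]. *)
Definition korobov_bound (R : realType) (alpha : R) (gamma : nat -> R)
    (d n : nat) (M : R) (z : 'rV[int]_d) : \bar R :=
  ((M^-1)%:E + korobov_sum alpha gamma n M z)%E.

(* Main.v *)
(* Both bounds sum G(k) = sum over 0 <> h in the dual lattice of 1/r(h + k).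
   Since r is invariant under sign changes and sigma is an involution,
   r(sigma(h) + k) = r(h + sigma(k)), so the cosine sum is the sum over k in
   H_M of 2^|k|_0 / 2^d times the sum of G(sigma(k)) over all sigma.  The latter
   sum depends only on (|k_1|, ..., |k_d|), and a vector of Z_+^d has exactly
   2^|k|_0 preimages under componentwise absolute value, so this equals 2^-d
   times the sum over sigma and over k in the full cross of G(sigma(k)); the
   full cross being invariant under each sigma, all 2^d inner sums agree.
   Finiteness: with S the sum of 1/r over Z^d, which factors into convergent
   p-series as 2 alpha > 1, G(k) <= S <= M S / r(k) on the cross, whence
   a bound M S^2. *)
Require Import Defs.
From mathcomp Require Import all_boot all_order all_algebra.
From mathcomp Require Import all_classical all_reals all_analysis.
From mathcomp Require Import lra.

Import Order.TTheory GRing.Theory Num.Theory.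
Local Open Scope classical_set_scope.
Local Open Scope ring_scope.

(** * Sums of nonnegative extended reals over arbitrary index sets *)

Lemma ge0_esumZl (R : realType) (T : choiceType) (D : set T) (c : R)
    (f : T -> \bar R) :
  0 <= c -> (forall i, 0 <= f i)%E ->
  (\esum_(i in D) (c%:E * f i) = c%:E * \esum_(i in D) f i)%E.
Proof.
have le c' (g : T -> \bar R) : 0 < c' -> (forall i, 0 <= g i)%E ->
    (\esum_(i in D) (c'%:E * g i) <= c'%:E * \esum_(i in D) g i)%E.
  move=> c'_gt0 g_ge0; apply: ge_ereal_sup => _ /= [X XD <-].
  rewrite -ge0_mule_fsumr// lee_wpmul2l ?lee_fin ?(ltW c'_gt0)//.
  by apply: ereal_sup_ubound; exists X.
rewrite le_eqVlt => /predU1P[<- _|c_gt0 f_ge0].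
  by rewrite mul0e esum1// => i _; rewrite mul0e.
(* The reverse inequality is [le] again, applied to the factor [c^-1] and the family
   [c%:E * f i]. *)
apply/eqP; rewrite eq_le le//= -lee_pdivlMl//.
have cf_ge0 i : (0 <= c%:E * f i)%E by rewrite mule_ge0// lee_fin ltW.
have cV_gt0 : 0 < c^-1 by rewrite invr_gt0.
apply: le_trans (le _ _ cV_gt0 cf_ge0).
apply: le_esum => i _.
by rewrite muleA -EFinM mulVf ?gt_eqF// mul1e.
Qed.

Lemma esum_fibers (R : realType) (T K : choiceType) (p : T -> K) (D : set K)
    (a : T -> \bar R) :
  (forall i, 0 <= a i)%E ->
  (\esum_(i in p @^-1` D) a i =
   \esum_(k in D) \esum_(i in p @^-1` [set k]) a i)%E.
Proof.
move=> a_ge0; rewrite esum_esum//; apply: reindex_esum; split.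
- by move=> [k i] [/= Dk pi]; rewrite pi.
- by move=> [k i] [l j]; rewrite !inE => -[/= _ <-] [/= _ <-] /= ->.
- by move=> i Di; exists (p i, i).
Qed.

Lemma sume_const (R : realType) (I : finType) (A : pred I) (x : \bar R) :
  (\sum_(i in A) x = #|A|%:R%:E * x)%E.
Proof. by rewrite mule_natl big_const -Monoid.iteropE. Qed.

(** * Convergence of p-series *)

Lemma esum_nat_lty (R : realType) (a : nat -> R) (C : R) :
  (forall i, 0 <= a i) -> (forall N, \sum_(i < N) a i <= C) ->
  (\esum_(i in [set: nat]) (a i)%:E < +oo)%E.
Proof.
move=> a_ge0 aC; apply: (@le_lt_trans _ _ C%:E); last exact: ltry.
rewrite -nneseries_esumT => [|i]; last by rewrite lee_fin.
apply: lime_le; first by apply: is_cvg_nneseries => i _ _; rewrite lee_fin.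
by apply: nearW => N; rewrite sumEFin lee_fin big_mkord.
Qed.

Lemma p_series_bounded (R : realType) (s : R) : 1 < s ->
  exists C, forall N, \sum_(i < N) (i.+1%:R `^ s)^-1 <= C.
Proof.
(* [q] is [2^(1-s)], the ratio of the geometric series that dominates the dyadic blocks; [s > 1]
   makes it less than 1. *)
move=> s_gt1; pose q : R := 2 * (2 `^ s)^-1.
have s_gt0 : 0 < s by apply: lt_trans s_gt1.
have q_gt0 : 0 < q by rewrite mulr_gt0// invr_gt0 powR_gt0.
have q_lt1 : q < 1.
  rewrite ltr_pdivrMr ?powR_gt0// mul1r -[X in X < _]powRr1//.
  by rewrite /powR pnatr_eq0/= ltr_expR ltr_pM2r// ln_gt0// ltr1n.
(* Cauchy condensation: the block [2^m <= i + 1 < 2^(m+1)] contributes at most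
   [2^m / (2^m)^s = q^m]. *)
have dyadic m : \sum_(i < 2 ^ m - 1) (i.+1%:R `^ s)^-1 <= \sum_(i < m) q ^+ i.
  elim: m => [|m IHm]; first by rewrite !big_ord0.
  rewrite -(big_mkord predT (fun i => (i.+1%:R `^ s)^-1)).
  rewrite (big_cat_nat _ (n := (2 ^ m - 1)%N))//=; last first.
    by rewrite leq_sub2r// leq_exp2l.
  rewrite big_mkord big_ord_recr/= lerD//.
  apply: (@le_trans _ _ (\sum_(2 ^ m - 1 <= i < 2 ^ m.+1 - 1)
                           ((2 ^ m)%:R `^ s)^-1)).
    apply: ler_sum_nat => i /andP[mi _].
    have le_mi : (2 ^ m <= i.+1)%N by rewrite leq_subLR add1n in mi.
    rewrite lef_pV2 ?posrE ?powR_gt0 ?ltr0n ?expn_gt0//.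
    by rewrite ge0_ler_powR ?nnegrE ?ler0n ?ler_nat ?(ltW s_gt0).
  rewrite sumr_const_nat.
  have -> : (2 ^ m.+1 - 1 - (2 ^ m - 1) = 2 ^ m)%N.
    by rewrite subnBA ?expn_gt0// subnK ?expn_gt0// expnS mul2n -addnn addnK.
  rewrite exprMn exprVn -[_ *+ _]mulr_natl natrX.
  have two_ge0 : 0 <= 2 :> R by [].
  rewrite -(powR_mulrn m (powR_ge0 2 s)) powRAC.
  by rewrite (powR_mulrn m two_ge0).
(* Since [N <= 2^N - 1], the first [N] terms lie within the first [N] dyadic blocks, and the full
   geometric series bounds these. *)
exists (1 - q)^-1 => N.
apply: (@le_trans _ _ (\sum_(i < 2 ^ N - 1) (i.+1%:R `^ s)^-1)).
  rewrite -!(big_mkord predT (fun i => (i.+1%:R `^ s)^-1)).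
  rewrite [leRHS](big_cat_nat _ (n := N))//=.
    by rewrite lerDl sumr_ge0// => i _; rewrite invr_ge0 powR_ge0.
  by rewrite leq_subRL ?expn_gt0// add1n ltn_expl.
apply: le_trans (dyadic N) _.
have q_norm : `|q| < 1 by rewrite ger0_norm ?ltW.
have := geometric_le_lim N ler01 q_gt0 q_norm.
rewrite mul1r; apply: le_trans.
by rewrite /series/= big_mkord; under [leRHS]eq_bigr do rewrite mul1r.
Qed.

(** * The weight and the summability of its inverse over [Z^d] *)

Section Weight.
Context {R : realType}.

Lemma r_weight1_gt0 (alpha g : R) (k : int) : 0 < g -> 0 < r_weight1 alpha g k.
Proof.
move=> g_gt0; rewrite /r_weight1; case: eqP => // /eqP k0.
by rewrite divr_gt0// powR_gt0// ltr0n absz_gt0.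
Qed.

Lemma r_weight_gt0 (alpha : R) (gamma : nat -> R) d (k : 'rV[int]_d) :
  (forall j, 0 < gamma j) -> 0 < r_weight alpha gamma k.
Proof. by move=> g_gt0; apply: prodr_gt0 => j _; apply: r_weight1_gt0. Qed.

Lemma esum_inv_r_weight1_lty (alpha g : R) : 1 / 2 < alpha -> 0 < g ->
  (\esum_(k in [set: int]) ((r_weight1 alpha g k)^-1)%:E < +oo)%E.
Proof.
move=> alpha_gt g_gt0.
have inv_ge0 k : 0 <= (r_weight1 alpha g k)^-1.
  by rewrite invr_ge0 ltW// r_weight1_gt0.
have [C leC] : exists C, forall N,
    \sum_(i < N) (i.+1%:R `^ (2 * alpha))^-1 <= C.
  by apply: p_series_bounded; lra.
have gE n : (n.+1%:R `^ (2 * alpha) / g)^-1 = g * (n.+1%:R `^ (2 * alpha))^-1.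
  by rewrite invfM invrK mulrC.
have C_ge0 : 0 <= C by have := leC 0%N; rewrite big_ord0.
(* [Z] splits into the images of [Posz] and [Negz], each of which leads to a p-series with exponent
   [2 * alpha > 1]. *)
rewrite (esumID (range Posz)) => [|k _]; last by rewrite lee_fin.
rewrite !setTI.
have -> : ~` range Posz = range Negz.
  apply/seteqP; split=> [[n|n]|_ [n _ <-]] /=; first by case; exists n.
    by move=> _; exists n.
  by case.
rewrite !esum_image; [|by move=> m n _ _ []|by move=> m n _ _ []].
apply: lte_add_pinfty.
  (* The extra 1 is the term at [k = 0]. The negative half has no such term, as [Negz n] is
     [-(n+1)]. *)
  apply: (@esum_nat_lty _ _ (1 + g * C)) => [i|[|N]]; first exact: inv_ge0.
    by rewrite big_ord0 addr_ge0// mulr_ge0// ltW.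
  rewrite big_ord_recl {1}/r_weight1 eqxx invr1 lerD2l.
  under eq_bigr do rewrite /r_weight1/= /bump/= add1n gE.
  by rewrite -mulr_sumr ler_pM2l.
apply: (@esum_nat_lty _ _ (g * C)) => [i|N]; first exact: inv_ge0.
under eq_bigr do rewrite /r_weight1/= gE.
by rewrite -mulr_sumr ler_pM2l.
Qed.

(** Splitting off the first coordinate factors the sum into a one-dimensional sum and a sum in one
    dimension less. The induction is over all families [f], because the remaining factors are the
    shifted family. *)
Lemma esum_prod_lty d (f : nat -> int -> R) :
  (forall j m, 0 <= f j m) ->
  (forall j, (\esum_(m in [set: int]) (f j m)%:E < +oo)%E) ->
  (\esum_(k in [set: 'rV[int]_d]) (\prod_(j < d) f j (k 0%R j))%:E < +oo)%E.
Proof.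
elim: d f => [|d IHd] f f_ge0 f_lty.
  have -> : [set: 'rV[int]_0] = [set 0].
    by apply/seteqP; split=> k // _ /=; apply: thinmx0.
  by rewrite esum_set1 ?lee_fin big_ord0 ?ltry.
(* [e] prepends [p.1] to [p.2]: [unlift ord0 j] is [None] exactly at the first coordinate. *)
pose e (p : int * 'rV[int]_d) : 'rV[int]_d.+1 :=
  \row_j oapp (p.2 0) p.1 (unlift ord0 j).
have e_bij : set_bij ([set: int] `*`` fun=> [set: 'rV[int]_d])
    [set: 'rV[int]_d.+1] e.
  split=> //.
    move=> [a v] [b w] _ _ /rowP eq_ab; congr (_, _).
      by have := eq_ab ord0; rewrite !mxE unlift_none.
    by apply/rowP => j; have := eq_ab (lift ord0 j); rewrite !mxE liftK.
  move=> k _; exists (k 0 ord0, \row_j k 0 (lift ord0 j)) => //.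
  by apply/rowP => j; rewrite mxE; case: unliftP => [i|] -> //=; rewrite mxE.
rewrite (reindex_esum _ _ _ _ e_bij).
under eq_esum => p _.
  rewrite big_ord_recl mxE unlift_none/=.
  under eq_bigr do rewrite mxE liftK/=.
  over.
pose g (v : 'rV[int]_d) := \prod_(i < d) f i.+1 (v 0 i).
have g_ge0 v : 0 <= g v by apply: prodr_ge0.
rewrite -(@esum_esum _ _ _ _ _ (fun a v =>
  (f 0%N a * g v)%:E)); last first.
  by move=> a v _ _; rewrite lee_fin mulr_ge0.
have /= S_lty :=
  IHd (fun j => f j.+1) (fun j => f_ge0 j.+1) (fun j => f_lty j.+1).
set S := esum _ _ in S_lty.
have S_ge0 : (0 <= S)%E by apply: esum_ge0 => v _; rewrite lee_fin g_ge0.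
have S_fin : S \is a fin_num by rewrite ge0_fin_numE.
have outer : (\esum_(a in [set: int]) \esum_(v in [set: 'rV[int]_d])
    (f 0%N a * g v)%:E =
    S * \esum_(a in [set: int]) (f 0%N a)%:E)%E.
  (* As [S] is finite, it can be treated as a real factor and moved inside the outer sum. *)
  rewrite -(fineK S_fin) -ge0_esumZl ?fine_ge0//; last first.
    by move=> a; rewrite lee_fin.
  apply: eq_esum => a _; rewrite fineK// muleC -ge0_esumZl//.
by rewrite outer lte_mul_pinfty.
Qed.

Lemma esum_inv_r_weight_lty (alpha : R) (gamma : nat -> R) d :
  1 / 2 < alpha -> (forall j, 0 < gamma j) ->
  (\esum_(k in [set: 'rV[int]_d]) ((r_weight alpha gamma k)^-1)%:E < +oo)%E.
Proof.
move=> alpha_gt gamma_gt0.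
under eq_esum do rewrite /r_weight -prodfV.
apply: (esum_prod_lty d (fun j m => (r_weight1 alpha (gamma j) m)^-1)) => j.
  by move=> m; rewrite invr_ge0 ltW// r_weight1_gt0.
exact: esum_inv_r_weight1_lty.
Qed.

End Weight.

(** * Sign changes and componentwise absolute values *)

Section SignFlip.
Context {d : nat}.
Implicit Types (s : {ffun 'I_d -> bool}) (k h : 'rV[int]_d).

Lemma sign_flipK s : involutive (sign_flip s).
Proof. by move=> k; apply/rowP => j; rewrite !mxE signrMK. Qed.

Lemma sign_flipD s h k : sign_flip s (h + k) = sign_flip s h + sign_flip s k.
Proof. by apply/rowP => j; rewrite !mxE mulrDr. Qed.

Lemma r_weight_sign_flip (R : realType) (alpha : R) (gamma : nat -> R) s k :
  r_weight alpha gamma (sign_flip s k) = r_weight alpha gamma k.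
Proof.
apply: eq_bigr => j _.
by rewrite mxE /r_weight1 mulf_eq0 signr_eq0 abszMsign.
Qed.

Definition row_abs k : 'rV[int]_d := map_mx Num.norm k.

Lemma row_abs_sign_flip s k : row_abs (sign_flip s k) = row_abs k.
Proof. by apply/rowP => j; rewrite !mxE normrMsign. Qed.

Lemma row_abs_flipE k :
  row_abs k = sign_flip [ffun j => k 0 j < 0] k.
Proof. by apply/rowP => j; rewrite !mxE ffunE normrEsign. Qed.

Lemma sign_flip_row_abs k :
  sign_flip [ffun j => k 0 j < 0] (row_abs k) = k.
Proof. by rewrite row_abs_flipE sign_flipK. Qed.

(** The absolute value of a vector is one of its sign flips, so passing to it leaves the weight
    unchanged. *)
Lemma crossZ_preimage (R : realType) (alpha : R) (gamma : nat -> R) (M : R) :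
  crossZ alpha gamma M =
  row_abs @^-1` crossN alpha gamma (d := d) M.
Proof.
apply/seteqP; split=> k; rewrite /crossZ /crossN/= row_abs_flipE
  r_weight_sign_flip; last by case.
by split=> // j; rewrite -row_abs_flipE mxE.
Qed.

Lemma esum_row_abs_fiber (R : realType) k (x : \bar R) :
  (forall j, 0 <= k 0 j) -> (0 <= x)%E ->
  (\esum_(l in row_abs @^-1` [set k]) x = (2 ^+ nnz k)%:E * x)%E.
Proof.
(* A sign at a zero coordinate has no effect. Hence [P] keeps only the sign vectors that are [false]
   off the support of [k]: they still reach the whole fiber, now injectively, and there are
   [2 ^ nnz k] of them. *)
move=> k_ge0 x_ge0; pose P := pffun_on false [pred j | k 0 j != 0] predT.
have absk : row_abs k = k by apply/rowP => j; rewrite mxE ger0_norm.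
have -> : row_abs @^-1` [set k] = (fun s => sign_flip s k) @` [set` P].
  apply/seteqP; split=> [l /= kl|_ [s _ <-]] /=; last first.
    by rewrite row_abs_sign_flip.
  exists [ffun j => l 0 j < 0]; last by rewrite -kl sign_flip_row_abs.
  apply/pffun_onP; split=> //; apply/fintype.subsetP => j.
  rewrite !inE ffunE eqbF_neg negbK -kl mxE.
  by rewrite normr_eq0; apply: ltr0_neq0.
rewrite esum_image => [|s t]; last first.
  rewrite !inE => /pffun_onP[/fintype.subsetP sk _].
  move=> /pffun_onP[/fintype.subsetP tk _] st.
  (* Off the support both signs are [false]; on it, cancelling [k 0 j] identifies them. *)
  apply/ffunP => j; have [kj0|kj0] := eqVneq (k 0 j) 0.
    have off (u : {ffun 'I_d -> bool}) :
        {subset false.-support u <= [pred j | k 0 j != 0]} -> u j = false.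
      move=> uk; apply/negbTE/negP => uj; have := uk j.
      by rewrite !inE uj kj0 eqxx => /(_ isT).
    by rewrite !off.
  have := congr1 (fun v : 'rV_d => v 0 j) st; rewrite !mxE => /(mulIf kj0).
  by case: (s j); case: (t j).
rewrite esum_fset//.
rewrite (fsbigE (enum P)) ?enum_uniq//; last 2 first.
- by move=> s /=; rewrite mem_enum.
- by move=> s /=; rewrite mem_enum => ->.
rewrite (eq_bigl (fun s => s \in enum P)); last first.
  by move=> s; rewrite mem_enum; apply/idP/idP; rewrite inE.
by rewrite -big_seq big_enum sume_const card_pffun_on card_bool natrX.
Qed.

Lemma esum_sign_flip (R : realType) (D : set 'rV[int]_d) s
    (F : 'rV[int]_d -> \bar R) :
  (forall k, D k -> D (sign_flip s k)) ->
  (\esum_(k in D) F (sign_flip s k) = \esum_(k in D) F k)%E.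
Proof.
move=> D_flip; symmetry; apply: reindex_esum; split=> //.
  by move=> k l _ _; apply: (can_inj (sign_flipK s)).
by move=> k Dk; exists (sign_flip s k); [apply: D_flip|rewrite sign_flipK].
Qed.

Lemma esum_sum_sign_flip (R : realType) (D : set 'rV[int]_d)
    (F : 'rV[int]_d -> \bar R) :
  (forall s k, D k -> D (sign_flip s k)) -> (forall k, 0 <= F k)%E ->
  (\esum_(k in D) \sum_s F (sign_flip s k) =
   (2 ^+ d)%:E * \esum_(k in D) F k)%E.
Proof.
move=> D_flip F_ge0; rewrite esum_sum => [|*]; last exact: F_ge0.
under eq_bigr => s _ do rewrite (esum_sign_flip _ _ _ _ (D_flip s)).
by rewrite sume_const card_ffun card_bool card_ord natrX.
Qed.

Lemma sum_sign_flip_row_abs (R : realType) (F : 'rV[int]_d -> \bar R) k :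
  (\sum_s F (sign_flip s (row_abs k)) = \sum_s F (sign_flip s k))%E.
Proof.
pose t : {ffun 'I_d -> bool} := [ffun j => k 0 j < 0].
(* Adding the sign pattern [t] of [k] modulo 2 permutes the sign vectors and absorbs the flip
   between [k] and [row_abs k]. *)
pose addt s : {ffun 'I_d -> bool} := [ffun j => s j (+) t j].
have addtK : involutive addt.
  by move=> s; apply/ffunP => j; rewrite !ffunE addbK.
rewrite [RHS](reindex_inj (inv_inj addtK)); apply: eq_bigr => s _; congr F.
apply/rowP => j; rewrite !mxE !ffunE normrEsign signr_addb.
by rewrite mulrA.
Qed.

End SignFlip.

(** * Finiteness of the Korobov sum and equality of the two sums *)

Lemma korobov_sum_lty (R : realType) (d n : nat) (alpha : R) (gamma : nat -> R)
    (M : R) (z : 'rV[int]_d) :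
  1 / 2 < alpha -> (forall j, 0 < gamma j) -> 0 < M ->
  (korobov_sum alpha gamma n M z < +oo)%E.
Proof.
move=> alpha_gt gamma_gt0 M_gt0; pose r := r_weight alpha gamma (d := d).
have r_gt0 k : 0 < r k by apply: r_weight_gt0.
have rV_ge0 k : 0 <= (r k)^-1 by rewrite invr_ge0 ltW.
have S_lty := esum_inv_r_weight_lty alpha gamma d alpha_gt gamma_gt0.
set S := esum _ _ in S_lty.
have S_ge0 : (0 <= S)%E by apply: esum_ge0 => k _; rewrite lee_fin.
have S_fin : S \is a fin_num by rewrite ge0_fin_numE.
have esum_subT (D : set 'rV[int]_d) (f : 'rV[int]_d -> \bar R) :
    (forall k, 0 <= f k)%E -> (esum D f <= esum setT f)%E.
  move=> f_ge0; rewrite esum_mkcond; apply: le_esum => k _.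
  by case: ifP.
(* Translation by [k] permutes [Z^d], so extending the sum from [D] to [Z^d] gives exactly [S]. *)
have inner D k : (\esum_(h in D) ((r (h + k))^-1)%:E <= S)%E.
  apply: le_trans (esum_subT _ _ _) _ => [h|]; first by rewrite lee_fin.
  rewrite [leRHS](@reindex_esum _ _ _ setT setT (+%R^~ k))//.
  split=> // [h l _ _ /addIr//|h _].
  by exists (h - k) => //; rewrite subrK.
have bound : (korobov_sum alpha gamma n M z <= (M * fine S)%:E * S)%E.
  rewrite -ge0_esumZl ?mulr_ge0 ?fine_ge0 ?(ltW M_gt0)//.
  apply: le_trans (esum_subT (crossZ alpha gamma M) _ _); last first.
    by move=> k; rewrite -EFinM lee_fin !mulr_ge0 ?fine_ge0 ?(ltW M_gt0).
  (* Membership in the cross means [1 <= M / r k]; this factor makes the outer sum converge. *)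
  apply: le_esum => k kM; apply: le_trans (inner _ k) _.
  rewrite -[leLHS]fineK// -EFinM lee_fin mulrAC ler_peMl ?fine_ge0//.
  by rewrite ler_pdivlMr ?mul1r.
by apply: le_lt_trans bound _; rewrite -(fineK S_fin) -EFinM ltry.
Qed.

Lemma cosine_sumE (R : realType) (d n : nat) (alpha : R) (gamma : nat -> R)
    (M : R) (z : 'rV[int]_d) :
  (forall j, 0 < gamma j) ->
  cosine_sum alpha gamma n M z = korobov_sum alpha gamma n M z.
Proof.
move=> gamma_gt0; pose r := r_weight alpha gamma (d := d).
have rV_ge0 k : 0 <= (r k)^-1 by rewrite invr_ge0 ltW// r_weight_gt0.
pose L := dual_lattice z n `\ (0 : 'rV[int]_d).
pose G k := (\esum_(h in L) ((r (h + k))^-1)%:E)%E.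
have G_ge0 k : (0 <= G k)%E by apply: esum_ge0 => h _; rewrite lee_fin.
have A_ge0 k : (0 <= \sum_s G (sign_flip s k))%E by apply: sume_ge0.
have cosE : cosine_sum alpha gamma n M z =
    (((2 ^+ d)^-1)%:E *
     \esum_(k in crossN alpha gamma M)
       ((2 ^+ nnz k)%:E * \sum_s G (sign_flip s k)))%E.
  rewrite -ge0_esumZl; [|by rewrite invr_ge0 exprn_ge0|]; last first.
    by move=> k; rewrite mule_ge0// lee_fin exprn_ge0.
  apply: eq_esum => k _; rewrite muleA -EFinM mulrC.
  rewrite esum_sum => [|h s _ _]; last first.
    by rewrite lee_fin divr_ge0 ?mulr_ge0 ?exprn_ge0// ltW// r_weight_gt0.
  rewrite ge0_sume_distrr//; apply: eq_bigr => s _.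
  rewrite -ge0_esumZl ?divr_ge0 ?exprn_ge0//; last first.
    by move=> h; rewrite lee_fin rV_ge0.
  apply: eq_esum => h _; rewrite -EFinM; congr EFin.
  have -> : sign_flip s h + k = sign_flip s (h + sign_flip s k).
    by rewrite sign_flipD sign_flipK.
  by rewrite r_weight_sign_flip invfM mulrA.
have fiberE : (\esum_(k in crossZ alpha gamma M) \sum_s G (sign_flip s k) =
    \esum_(k in crossN alpha gamma M)
       ((2 ^+ nnz k)%:E * \sum_s G (sign_flip s k)))%E.
  (* The full cross is grouped by absolute value. On the fiber over [k] the summand is constant, so
     the fiber contributes its size [2 ^+ nnz k] as a factor. *)
  rewrite crossZ_preimage esum_fibers//.
  apply: eq_esum => k [k_ge0 _].
  rewrite -(esum_row_abs_fiber _ k _ k_ge0 (A_ge0 k)).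
  apply: eq_esum => l kl.
  have := sum_sign_flip_row_abs _ G l.
  rewrite (kl : row_abs l = k).
  exact: esym.
rewrite cosE -fiberE esum_sum_sign_flip//; last first.
  by move=> s k kM; rewrite /crossZ/= r_weight_sign_flip.
by rewrite muleA -EFinM mulVf ?expf_neq0 ?pnatr_eq0// mul1e.
Qed.

Theorem theorem7 (R : realType) (d n : nat) (alpha : R) (gamma : nat -> R)
    (M : R) (z : 'rV[int]_d)
    (d_gt0 : (0 < d)%N) (n_gt0 : (0 < n)%N)
    (alpha_gt : 1 / 2 < alpha)
    (gamma_le1 : gamma 0%N <= 1)
    (gamma_noninc : forall j : nat, gamma j.+1 <= gamma j)
    (gamma_gt0 : forall j : nat, 0 < gamma j)
    (M_ge1 : 1 <= M)
    (z_range : forall j : 'I_d, 0 <= z 0 j < n%:Z) :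
  [/\ cosine_sum alpha gamma n M z \is a fin_num,
      korobov_sum alpha gamma n M z \is a fin_num,
      cosine_sum alpha gamma n M z = korobov_sum alpha gamma n M z &
      cosine_bound alpha gamma n M z = korobov_bound alpha gamma n M z].
Proof.
rewrite /cosine_bound cosine_sumE//.
(* With the two sums identified, only finiteness remains, and nonnegativity reduces it to being
   below [+oo]. *)
have korobov_ge0 : (0 <= korobov_sum alpha gamma n M z)%E.
  apply: esum_ge0 => k _; apply: esum_ge0 => h _.
  by rewrite lee_fin invr_ge0 ltW// r_weight_gt0.
have M_gt0 : 0 < M by apply: lt_le_trans M_ge1.
by rewrite ge0_fin_numE// korobov_sum_lty.
Qed.
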